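(* Let $J\subset\mathbb R$ be an interval, let $A$ be a continuous real $n\times n$ matrix function on $J$ that is diagonalizable by a constant similarity matrix, and let $B(t)=A(t)^{T}$. Let $\nu=\overset{*}{\nu}+\widetilde\nu\, i$ ($\overset{*}{\nu}=\mathrm{Re}\,\nu$, $\widetilde\nu=\mathrm{Im}\,\nu\neq0$) be a complex (constant) eigenvector of $B(t)$, $t\in J$, corresponding to the eigenfunction $\lambda(t)=\overset{*}{\lambda}(t)+\widetilde\lambda(t)\, i$ ($\overset{*}{\lambda}(t)=\mathrm{Re}\,\lambda(t)$, $\widetilde\lambda(t)=\mathrm{Im}\,\lambda(t)$), i.e. $B(t)\nu=\lambda(t)\nu$ for all $t\in J$. Fix $t_0\in J$. Then the functions $$F_1\colon(t,x)\mapsto\bigl((\overset{*}{\nu}x)^2+(\widetilde\nu x)^2\bigr)\exp\Bigl(-2\int_{t_0}^{t}\overset{*}{\lambda}(\zeta)\,d\zeta\Bigr)\quad\text{for all }(t,x)\in J\times\mathbb R^n$$ and $$F_2\colon(t,x)\mapsto\arctan\frac{\widetilde\nu x}{\overset{*}{\nu}x}-\int_{t_0}^{t}\widetilde\lambda(\zeta)\,d\zeta\quad\text{for all }(t,x)\in J\times\mathscr X,$$ where $\mathscr X$ is any domain contained in $\{x\in\mathbb R^n\colon\overset{*}{\nu}x\neq0\}$, are first integrals of the system $\dfrac{dx}{dt}=A(t)x$.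
   Context: A domain is an open arcwise connected set. For a vector $\nu=(\nu_1,\dots,\nu_n)$ and $x\in\mathbb R^n$, $\nu x=\sum_{\xi=1}^n\nu_\xi x_\xi$; eigenvectors are regarded as columns in $B(t)\nu=\lambda(t)\nu$. ''$A$ is diagonalizable by a constant similarity matrix'' means that there is a constant nonsingular (possibly complex) matrix $S$ such that $S^{-1}A(t)S$ is diagonal for all $t\in J$ (such systems are called algebraic reducible). A first integral of $dx/dt=X(t,x)$ on a domain $G'$ is a continuously differentiable function $F\colon G'\to\mathbb R$ with $\partial_tF(t,x)+\sum_{\xi=1}^nX_\xi(t,x)\,\partial_{x_\xi}F(t,x)=0$ for all $(t,x)\in G'$. *)

(* Defs.v *)
From mathcomp Require Import all_boot all_order all_algebra.
From mathcomp Require Import complex.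
From mathcomp Require Import all_classical all_reals all_analysis.

Set Implicit Arguments.
Unset Strict Implicit.
Unset Printing Implicit Defensive.

Import Order.TTheory GRing.Theory Num.Theory.
Import numFieldNormedType.Exports.

Local Open Scope classical_set_scope.
Local Open Scope ring_scope.

Definition arcwise_connected (R : realType) (T : topologicalType)
    (D : set T) : Prop :=
  forall x y : T, D x -> D y -> exists g : R -> T,
    [/\ {within `[0, 1], continuous g}, g 0 = x, g 1 = y &
        forall s : R, s \in `[0, 1] -> D (g s)].

Definition is_domain (R : realType) (T : topologicalType) (D : set T) : Prop :=
  open D /\ arcwise_connected R D.

Definition dotv (R : realType) (n : nat) (u x : 'cV[R]_n) : R :=
  \sum_(k < n) u k ord0 * x k ord0.

Definition re_cV (R : realType) (n : nat) (v : 'cV[R[i]]_n) : 'cV[R]_n :=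
  map_mx (@complex.Re R) v.

Definition im_cV (R : realType) (n : nat) (v : 'cV[R[i]]_n) : 'cV[R]_n :=
  map_mx (@complex.Im R) v.

Definition complex_mx (R : realType) (n : nat) (M : 'M[R]_n) : 'M[R[i]]_n :=
  map_mx (real_complex R) M.

(* The set-indexed integral of the library does not see the orientation of
   the bounds; here the value for b < a is minus the integral over [b, a]. *)
Definition oriented_int (R : realType) (f : R -> R) (a b : R) : R :=
  if a <= b then \int[@lebesgue_measure R]_(z in `[a, b]) f z
  else - \int[@lebesgue_measure R]_(z in `[b, a]) f z.

(* Derivative of f at p in the direction v, with only increments that stay in
   D.  On an open D this is the library's is_derive (lemma below); on a
   product of an interval with an open set it gives the one-sided derivative
   in time at the endpoints of the interval. *)
Definition derives_within (R : realType) (V : normedModType R) (D : set V)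
    (f : V -> R) (p v : V) (l : R) : Prop :=
  (h^-1 * (f (h *: v + p) - f p))
    @[h --> within [set h : R | D (h *: v + p)] (0 : R)^'] --> l.

Lemma derives_within_open (R : realType) (V : normedModType R) (D : set V)
    (f : V -> R) (p v : V) (l : R) :
  open D -> D p -> derives_within D f p v l <-> is_derive p v f l.
Proof.
move=> oD Dp; rewrite /derives_within.
have c : (fun h : R => h *: v + p) @ (0 : R) --> p.
  rewrite -[X in _ --> X]add0r -(scale0r v).
  apply: cvgD; last exact: cvg_cst.
  by apply: cvgZr_tmp; exact: cvg_id.
have nD : nbhs (0 : R)^' [set h : R | D (h *: v + p)].
  by apply: (cvg_within (F := nbhs (0 : R))); apply: c; exact: open_nbhs_nbhs.
have -> : within [set h : R | D (h *: v + p)] (0 : R)^' = (0 : R)^'.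
  apply/seteqP; split => P /= hP.
    by apply: filterS2 nD hP => h Dh; apply.
  by apply: filterS hP => h Ph _.
split=> [H|[dH <-]]; last exact: dH.
by split; [apply/cvg_ex; exists l; exact: H | exact: cvg_lim H].
Qed.

Definition time_dir (R : realType) (n : nat) : R * 'cV[R]_n := (1, 0).

Definition space_dir (R : realType) (n : nat) (k : 'I_n) : R * 'cV[R]_n :=
  (0, delta_mx k ord0).

(* Ft and Fx k are the partial derivatives of F on G; continuity of all of
   them on G is what makes F continuously differentiable there. *)
Definition first_integral (R : realType) (n : nat)
    (X : R -> 'cV[R]_n -> 'cV[R]_n) (G : set (R * 'cV[R]_n))
    (F : R * 'cV[R]_n -> R) : Prop :=
  exists (Ft : R * 'cV[R]_n -> R) (Fx : 'I_n -> R * 'cV[R]_n -> R),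
    [/\ {within G, continuous Ft},
        forall k, {within G, continuous (Fx k)},
        forall p, G p -> derives_within G F p (time_dir R n) (Ft p),
        forall p k, G p -> derives_within G F p (space_dir R k) (Fx k p) &
        forall p, G p ->
          Ft p + \sum_(k < n) X p.1 p.2 k ord0 * Fx k p = 0].

(* Main.v *)
(* Put z = nu x and split it as z = alpha + i beta, with alpha = (Re nu) x and
   beta = (Im nu) x.  Along the system x' = A(t) x the eigenvector equation
   A(t)^T nu = lambda(t) nu gives z' = lambda(t) z, so that |z|^2 grows at the
   rate 2 Re lambda and the argument of z at the rate Im lambda; subtracting
   the corresponding integrals leaves constants of motion.  The analytic input
   is the fundamental theorem of calculus for lambda, which is continuous on J
   because the eigenvector is constant and nonzero. *)
Require Import Defs.
From mathcomp Require Import all_boot all_order all_algebra.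
From mathcomp Require Import complex ring lra.
From mathcomp Require Import all_classical all_reals all_analysis.

Set Implicit Arguments.
Unset Strict Implicit.

Import Order.TTheory GRing.Theory Num.Theory.
Import numFieldNormedType.Exports.

Local Open Scope classical_set_scope.
Local Open Scope ring_scope.

(** * Oriented integrals on an interval and their local primitives *)

(** If [J] has a point strictly below [t], the smaller of that point and [t0] bounds all [s] near
    [t] from below; otherwise [t] is the least element of [J] and bounds [J] itself. The upper end
    is symmetric. This reduces work near [t], endpoint or not, to a compact segment of [J] that also
    contains [t0]. *)
Lemma locally_segment_in_interval (R : realType) (J : interval R) (t0 t : R) :
  t0 \in J -> t \in J ->
  exists a b : R, [/\ a \in J, b \in J, a <= t0 <= b, a <= t <= b &
    \forall s \near t, s \in J -> a <= s <= b].
Proof.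
move=> t0J tJ.
have [a [aJ at0 at1 aP]] : exists a, [/\ a \in J, a <= t0, a <= t &
    \forall s \near t, s \in J -> a <= s].
  have [[c [cJ ct]]|Hno] := pselect (exists c, c \in J /\ c < t).
    exists (Num.min c t0); split; rewrite ?ge_min ?lexx ?orbT ?(ltW ct)//.
      by rewrite minEle; case: ifP.
    near=> s => _; rewrite ge_min; apply/orP; left.
    by near: s; exact: lt_le_nbhsr.
  have tmin s : s \in J -> t <= s.
    by move=> sJ; rewrite leNgt; apply/negP => st; apply: Hno; exists s.
  exists t; split=> //; first exact: tmin.
  by apply: (@filterE _ (nbhs t)) => s; exact: tmin.
have [b [bJ bt0 bt1 bP]] : exists b, [/\ b \in J, t0 <= b, t <= b &
    \forall s \near t, s \in J -> s <= b].
  have [[c [cJ ct]]|Hno] := pselect (exists c, c \in J /\ t < c).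
    exists (Num.max c t0); split; rewrite ?le_max ?lexx ?orbT ?(ltW ct)//.
      by rewrite maxEle; case: ifP.
    near=> s => _; rewrite le_max; apply/orP; left.
    by near: s; exact: lt_le_nbhsl.
  have tmax s : s \in J -> s <= t.
    by move=> sJ; rewrite leNgt; apply/negP => st; apply: Hno; exists s.
  exists t; split=> //; first exact: tmax.
  by apply: (@filterE _ (nbhs t)) => s; exact: tmax.
exists a, b; split=> //; [exact/andP|exact/andP|].
by apply: filterS2 aP bP => s sa sb sJ; rewrite sa ?sb.
Unshelve. all: by end_near. Qed.

(** The clamp onto [[a, b]] is continuous and takes its values in [J], so continuity of [f] within
    [J] is enough at every real [x]. *)
Lemma within_continuous_clamp (R : realType) (J : interval R) (f : R -> R)
    (a b : R) :
  {within [set` J], continuous f} -> a \in J -> b \in J -> a <= b ->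
  continuous (fun x => f (Num.max a (Num.min x b))).
Proof.
move=> /subspace_continuousP fJ aJ bJ ab x.
have cJ y : Num.max a (Num.min y b) \in J.
  apply: (@interval_is_interval _ J a b aJ bJ).
  by rewrite le_max lexx /= ge_max ab ge_min lexx orbT.
have cc : {for x, continuous (fun y => Num.max a (Num.min y b))}.
  apply: (@continuous_max R R (cst a) (fun y => Num.min y b)).
    exact: cst_continuous.
  apply: (@continuous_min R R id (cst b)); first exact: cvg_id.
  exact: cst_continuous.
move=> P /(fJ _ (cJ x)) /cc H.
by apply: (@filterS _ (nbhs x) _ _ _ _ H) => y; apply; exact: cJ.
Qed.

(** Additivity over adjacent segments, with both orders of [x] and [y] covered. It trades the
    oriented integral for integrals with a fixed lower bound [c], the form handled by the
    fundamental theorem of calculus. *)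
Lemma oriented_intB (R : realType) (g : R -> R) (c x y : R) :
  continuous g -> c <= x -> c <= y ->
  oriented_int g x y = \int[@lebesgue_measure R]_(z in `[c, y]) g z
                     - \int[@lebesgue_measure R]_(z in `[c, x]) g z.
Proof.
move=> gc.
have gi (u v : R) : (@lebesgue_measure R).-integrable `[u, v] (EFin \o g).
  apply: continuous_compact_integrable; first exact: segment_compact.
  exact: continuous_subspaceT.
have main u v : c <= u -> u <= v ->
    \int[@lebesgue_measure R]_(z in `[u, v]) g z =
    \int[@lebesgue_measure R]_(z in `[c, v]) g z -
    \int[@lebesgue_measure R]_(z in `[c, u]) g z.
  move=> cu uv; rewrite Rintegral_itvB ?bnd_simp//.
  rewrite Rintegral_itv_obnd_cbnd//.
  apply: integrableS (gi u v) => //.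
  by apply: subset_itvr; rewrite bnd_simp.
move=> cx cy; rewrite /oriented_int; case: ifPn => [xy|]; first exact: main.
by rewrite -ltNge => /ltW yx; rewrite (main y x)// opprB.
Qed.

(* The constant extension of f outside a segment of J is continuous on all of
   R, so the fundamental theorem of calculus applies also at endpoints of J. *)
Lemma oriented_int_local_primitive (R : realType) (J : interval R)
    (f : R -> R) (t0 t : R) :
  {within [set` J], continuous f} -> t0 \in J -> t \in J ->
  exists G : R -> R, is_derive t 1 G (f t) /\
    \forall s \near t, s \in J -> oriented_int f t0 s = G s.
Proof.
move=> fJ t0J tJ.
have [a [b [aJ bJ /andP[at0 t0b] /andP[at1 tb] sab]]] :=
  locally_segment_in_interval t0J tJ.
have ab := le_trans at1 tb.
set g := fun x => f (Num.max a (Num.min x b)).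
have gc : continuous g by exact: within_continuous_clamp.
have gE x : a <= x -> x <= b -> g x = f x.
  by move=> ax xb; rewrite /g (min_l xb) (max_r ax).
(* The lower bound [a - 1] lies strictly to the left of [t] even when [t = a], and [t + 1] below
   plays the same role on the right, so that [t] is an interior point for the fundamental
   theorem. *)
exists (fun s => \int[@lebesgue_measure R]_(z in `[a - 1, s]) g z
  - \int[@lebesgue_measure R]_(z in `[a - 1, t0]) g z); split.
  have := @continuous_FTC1_closed _ g (a - 1) t (t + 1).
  case=> [||||dG G'].
  - by rewrite ltrDl.
  - apply: continuous_compact_integrable; first exact: segment_compact.
    exact: continuous_subspaceT.
  - by lra.
  - exact: gc.
  rewrite -(gE t)// -G' -[X in is_derive _ _ _ X]subr0.
  apply: (@is_deriveB _ _ _ _ (cst _)).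
  by rewrite derive1E; exact: derivableP.
(* For [s] in [J] near [t], both [s] and [t0] lie in [[a, b]], where [g] and [f] agree; hence so do
   their integrals between [t0] and [s]. *)
apply: filterS sab => s sab /sab/andP[as_ sb].
rewrite -(@oriented_intB R g) ?lerBlDr; [|exact: gc|lra|lra].
by rewrite /oriented_int; case: ifPn => [ts|]; last (rewrite -ltNge => /ltW ts;
  congr (- _)); apply: eq_Rintegral => z; rewrite inE/= in_itv/= => /andP[? ?];
  rewrite gE//; lra.
Qed.

(** Near each [t] in [J] the integral agrees on [J] with a function differentiable, hence
    continuous, at [t]. *)
Lemma oriented_int_within_continuous (R : realType) (J : interval R)
    (f : R -> R) (t0 : R) :
  {within [set` J], continuous f} -> t0 \in J ->
  {within [set` J], continuous (oriented_int f t0)}.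
Proof.
move=> fJ t0J; apply/subspace_continuousP => t tJ.
have [G [dG GE]] := oriented_int_local_primitive fJ t0J tJ.
have -> : nbhs (oriented_int f t0 t) = nbhs (G t).
  by rewrite (nbhs_singleton GE tJ).
apply: cvg_trans.
  apply: (@near_eq_cvg _ _ (within [set` J] (nbhs t)) _ G).
  by apply: (filterS _ GE) => s Es sJ; exact/esym/Es.
apply: cvg_within_filter; apply: differentiable_continuous.
by apply/derivable1_diffP; case: dG.
Qed.

(** * Derivatives along lines, and continuity of the building blocks *)

(** The difference quotient sees [F] only on the part of the line that lies in [D], so an ordinary
    derivative of [g] suffices. The parameter is shifted to put [p] at [h = s]: time derivatives use
    [s = t], space derivatives [s = 0]. *)
Lemma derives_within_line (R : realType) (V : normedModType R) (D : set V)
    (F : V -> R) (p v : V) (g : R -> R) (s l : R) :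
  is_derive s 1 g l -> D p ->
  (\forall h \near s, D ((h - s) *: v + p) -> F ((h - s) *: v + p) = g h) ->
  derives_within D F p v l.
Proof.
move=> dg Dp gE.
have Fp : F p = g s.
  by have := nbhs_singleton gE; rewrite subrr scale0r add0r; exact.
have shiftE : \forall h \near (0 : R),
    D (h *: v + p) -> F (h *: v + p) = g (h + s).
  have sc : (h + s) @[h --> (0 : R)] --> s.
    rewrite -[X in _ --> X]add0r.
    by apply: cvgD; [exact: cvg_id|exact: cvg_cst].
  have H := sc _ gE.
  by apply: (@filterS _ (nbhs (0 : R)) _ _ _ _ H) => h /=; rewrite addrK.
rewrite /derives_within; apply: cvg_trans.
  apply: (@near_eq_cvg _ _ (within [set h : R | D (h *: v + p)] (0 : R)^') _
    (fun h => h^-1 *: (g (h *: 1 + s) - g s))).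
  have {}shiftE := cvg_within (FF := nbhs_filter (0 : R))
    (fun h : R => h != 0) shiftE.
  apply: (@filterS _ (dnbhs (0 : R)) _ _ _ _ shiftE) => h hE Dh.
  by rewrite Fp hE// /GRing.scale/= mulr1.
apply: cvg_within_filter.
have [dgs <-] := dg.
exact: dgs.
Qed.

Lemma within_continuous_fst (R : realType) (T : topologicalType) (D : set R)
    (X : set T) (u : R -> R) :
  {within D, continuous u} -> {within D `*` X, continuous (fun p => u p.1)}.
Proof.
move=> /subspace_continuousP uD; apply/subspace_continuousP => p [Dp Xp].
move=> P /(uD _ Dp) H.
have fstc : fst @ nbhs p --> p.1 by exact: cvg_fst.
have {}H := fstc _ H.
by apply: (@filterS _ (nbhs p) _ _ _ _ H) => q /= + [Dq _]; exact.
Qed.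

Lemma dotv_continuous (R : realType) (n : nat) (u : 'cV[R]_n) :
  continuous (dotv u).
Proof.
move=> x; apply: (cvg_big (F := nbhs x) add_continuous) => k _.
apply: (@continuousM _ _ (cst (u k ord0)) (fun y : 'cV[R]_n => y k ord0)).
  exact: cst_continuous.
exact: coord_continuous.
Qed.

Lemma within_continuous_dotv_snd (R : realType) (n : nat) (u : 'cV[R]_n)
    (G : set (R * 'cV[R]_n)) :
  {within G, continuous (fun p => dotv u p.2)}.
Proof.
apply: continuous_subspaceT => p.
have sndc : snd @ nbhs p --> p.2 by exact: cvg_snd.
exact: cvg_comp sndc (@dotv_continuous R n u p.2).
Qed.

Lemma dotv_line (R : realType) (n : nat) (u x : 'cV[R]_n) (k : 'I_n) (h : R) :
  dotv u (h *: delta_mx k ord0 + x) = h * u k ord0 + dotv u x.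
Proof.
rewrite /dotv; under eq_bigr do rewrite !mxE mulrDr.
rewrite big_split /= (bigD1 k)//= !eqxx big1 ?addr0 ?mulr1 1?mulrC//.
by move=> j /negPf ->; rewrite !mulr0.
Qed.

(** * Real and imaginary parts of the eigenvector equation *)

Lemma Re_sum (R : realType) (I : finType) (F : I -> R[i]) :
  complex.Re (\sum_i F i) = \sum_i complex.Re (F i).
Proof. by apply: (big_morph (@complex.Re R)) => // -[? ?] [? ?]. Qed.

Lemma Im_sum (R : realType) (I : finType) (F : I -> R[i]) :
  complex.Im (\sum_i F i) = \sum_i complex.Im (F i).
Proof. by apply: (big_morph (@complex.Im R)) => // -[? ?] [? ?]. Qed.

Lemma Re_realM (R : realType) (a : R) (z : R[i]) :
  complex.Re (real_complex R a * z) = a * complex.Re z.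
Proof. by case: z => x y /=; rewrite mul0r subr0. Qed.

Lemma Im_realM (R : realType) (a : R) (z : R[i]) :
  complex.Im (real_complex R a * z) = a * complex.Im z.
Proof. by case: z => x y /=; rewrite mul0r addr0. Qed.

Lemma eigen_coord (R : realType) (n : nat) (A : 'M[R]_n) (nu : 'cV[R[i]]_n)
    (l : R[i]) (j : 'I_n) :
  complex_mx A^T *m nu = l *: nu ->
  \sum_k real_complex R (A k j) * nu k ord0 = l * nu j ord0.
Proof.
move=> /matrixP/(_ j ord0); rewrite !mxE => <-.
by apply: eq_bigr => k _; rewrite !mxE.
Qed.

Lemma dotv_mulmx (R : realType) (n : nat) (A : 'M[R]_n) (u x : 'cV[R]_n) :
  dotv u (A *m x) = dotv (A^T *m u) x.
Proof.
rewrite /dotv; under eq_bigr do rewrite mxE mulr_sumr.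
rewrite exchange_big; apply: eq_bigr => j _; rewrite mxE mulr_suml.
by apply: eq_bigr => k _; rewrite mxE; ring.
Qed.

(** This is the real part of [z' = lambda z]: transposition moves [A] onto [nu], and since [A] and
    [x] are real, taking real parts commutes with the sums. *)
Lemma dotv_re_eigen (R : realType) (n : nat) (A : 'M[R]_n) (nu : 'cV[R[i]]_n)
    (l : R[i]) (x : 'cV[R]_n) :
  complex_mx A^T *m nu = l *: nu ->
  dotv (re_cV nu) (A *m x) =
  complex.Re l * dotv (re_cV nu) x - complex.Im l * dotv (im_cV nu) x.
Proof.
move=> lnu; rewrite dotv_mulmx /dotv !mulr_sumr -sumrB; apply: eq_bigr => j _.
have := congr1 (@complex.Re R) (eigen_coord j lnu); rewrite Re_sum !mxE.
under eq_bigr do rewrite Re_realM.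
under [X in _ -> X * _ = _]eq_bigr do rewrite !mxE.
by move=> ->; case: l {lnu} (nu j ord0) => [a b] [c d] /=; ring.
Qed.

Lemma dotv_im_eigen (R : realType) (n : nat) (A : 'M[R]_n) (nu : 'cV[R[i]]_n)
    (l : R[i]) (x : 'cV[R]_n) :
  complex_mx A^T *m nu = l *: nu ->
  dotv (im_cV nu) (A *m x) =
  complex.Im l * dotv (re_cV nu) x + complex.Re l * dotv (im_cV nu) x.
Proof.
move=> lnu; rewrite dotv_mulmx /dotv !mulr_sumr -big_split.
apply: eq_bigr => j _.
have := congr1 (@complex.Im R) (eigen_coord j lnu); rewrite Im_sum !mxE.
under eq_bigr do rewrite Im_realM.
under [X in _ -> X * _ = _]eq_bigr do rewrite !mxE.
by move=> ->; case: l {lnu} (nu j ord0) => [a b] [c d] /=; ring.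
Qed.

(* Dividing a coordinate of the eigenvector equation by a nonzero entry of nu
   writes lambda as a combination of entries of A with constant coefficients. *)
Lemma eigenfunction_continuous (R : realType) (n : nat) (J : interval R)
    (A : R -> 'M[R]_n) (nu : 'cV[R[i]]_n) (lambda : R -> R[i]) :
  {within [set` J], continuous A} -> nu != 0 ->
  (forall t, t \in J -> complex_mx (A t)^T *m nu = lambda t *: nu) ->
  {within [set` J], continuous (fun t => complex.Re (lambda t))} /\
  {within [set` J], continuous (fun t => complex.Im (lambda t))}.
Proof.
move=> /subspace_continuousP Ac nu0 lnu.
have [j nuj0] : exists j, nu j ord0 != 0.
  apply/existsP; apply: contraNT nu0; rewrite negb_exists => /forallP nu0.
  apply/eqP/matrixP => i k; rewrite ord1 mxE; apply/eqP.
  by have := nu0 i; rewrite negbK.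
have lE t : t \in J ->
    lambda t = \sum_k real_complex R (A t k j) * (nu k ord0 / nu j ord0).
  move=> tJ; under eq_bigr do rewrite mulrA.
  by rewrite -mulr_suml (eigen_coord j (lnu t tJ)) mulfK.
have Acoord k : {within [set` J], continuous (fun t => A t k j)}.
  apply/subspace_continuousP => t tJ.
  exact: cvg_comp (Ac t tJ) (@coord_continuous _ _ _ k j (A t)).
have comb (c : 'I_n -> R) :
    {within [set` J], continuous (fun t => \sum_k A t k j * c k)}.
  apply/subspace_continuousP => t tJ; apply: (cvg_big add_continuous) => k _.
  apply: cvgM; last exact: cvg_cst.
  by have /subspace_continuousP := Acoord k; exact.
split.
- apply: (@subspace_eq_continuous _ _ _
    (fun t => \sum_k A t k j * complex.Re (nu k ord0 / nu j ord0)));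
    last exact: comb.
  move=> t /[!inE] tJ; rewrite /from_subspace lE// Re_sum.
  by apply: eq_bigr => k _; rewrite Re_realM.
- apply: (@subspace_eq_continuous _ _ _
    (fun t => \sum_k A t k j * complex.Im (nu k ord0 / nu j ord0)));
    last exact: comb.
  move=> t /[!inE] tJ; rewrite /from_subspace lE// Im_sum.
  by apply: eq_bigr => k _; rewrite Im_realM.
Qed.

(** * Arithmetic of real functions continuous within a set *)

Section WithinContinuous.
Context (R : realType) (T : topologicalType) (G : set T).
Implicit Types f g : T -> R.

Lemma within_continuous_cst (c : R) : {within G, continuous (fun=> c : R)}.
Proof. by apply: continuous_subspaceT => p; exact: cvg_cst. Qed.

Lemma within_continuousD f g :
  {within G, continuous f} -> {within G, continuous g} ->
  {within G, continuous (fun p => f p + g p)}.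
Proof. by move=> fc gc p; exact: (continuousD (fc p) (gc p)). Qed.

Lemma within_continuousM f g :
  {within G, continuous f} -> {within G, continuous g} ->
  {within G, continuous (fun p => f p * g p)}.
Proof. by move=> fc gc p; exact: (continuousM (fc p) (gc p)). Qed.

Lemma within_continuousN f :
  {within G, continuous f} -> {within G, continuous (fun p => - f p)}.
Proof. by move=> fc p; exact: (continuousN (fc p)). Qed.

Lemma within_continuousV f :
  {within G, continuous f} -> (forall p, G p -> f p != 0) ->
  {within G, continuous (fun p => (f p)^-1)}.
Proof.
move=> /subspace_continuousP fc f0; apply/subspace_continuousP => p Gp.
by apply: cvgV; [exact: f0|exact: fc].
Qed.

Lemma within_continuous_comp (h : R -> R) f :
  continuous h -> {within G, continuous f} ->
  {within G, continuous (fun p => h (f p))}.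
Proof.
move=> hc /subspace_continuousP fc; apply/subspace_continuousP => p Gp.
exact: cvg_comp (fc p Gp) (hc (f p)).
Qed.

End WithinContinuous.

(** * Calculus along coordinate lines *)

Lemma is_derive_affine (R : realType) (c d s : R) :
  is_derive s 1 (fun h : R => h * c + d) c.
Proof.
rewrite -[X in is_derive _ _ _ X]addr0.
apply: (@is_deriveD _ _ _ (fun h : R => h * c) (cst d)).
rewrite (_ : (fun h : R => h * c) = c \*: id).
  by rewrite -[X in is_derive _ _ _ X]mulr1; exact: is_deriveZ.
by apply/funext => h; rewrite /GRing.scale/= mulrC.
Qed.

Lemma is_derive_affine_sq (R : realType) (c d s : R) :
  is_derive s 1 (fun h : R => (h * c + d) ^+ 2) (2 * (s * c + d) * c).
Proof.
have := is_deriveM (is_derive_affine c d s) (is_derive_affine c d s).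
by move/is_derive_eq; apply; rewrite /GRing.scale/=; ring.
Qed.

Lemma sum_mul_dotv (R : realType) (n : nat) (c : R) (w y : 'cV[R]_n) :
  \sum_k y k ord0 * (c * w k ord0) = c * dotv w y.
Proof. by rewrite /dotv mulr_sumr; apply: eq_bigr => k _; ring. Qed.

Lemma time_line (R : realType) (n : nat) (s t : R) (x : 'cV[R]_n) :
  (s - t) *: time_dir R n + (t, x) = (s, x).
Proof.
by congr pair; rewrite /= ?scaler0 ?add0r// /GRing.scale/= mulr1 subrK.
Qed.

Lemma space_line (R : realType) (n : nat) (k : 'I_n) (h t : R) (x : 'cV[R]_n) :
  (h - 0) *: space_dir R k + (t, x) = (t, h *: delta_mx k ord0 + x).
Proof. by congr pair; rewrite /= subr0 ?scaler0 ?add0r. Qed.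

(** * The two first integrals *)

(** With [alpha = dotv u x] and [beta = dotv v x], the space gradient of [alpha^2 + beta^2] is
    [2 (alpha u + beta v)]. Paired with [A x], its terms in Im lambda cancel and
    [2 Re lambda (alpha^2 + beta^2)] remains, which the time derivative of the exponential
    offsets. *)
Lemma first_integral_modulus (R : realType) (n : nat) (J : interval R)
    (A : R -> 'M[R]_n) (nu : 'cV[R[i]]_n) (lambda : R -> R[i]) (t0 : R) :
  {within [set` J], continuous (fun t => complex.Re (lambda t))} ->
  (forall t, t \in J -> complex_mx (A t)^T *m nu = lambda t *: nu) ->
  t0 \in J ->
  first_integral (fun t x => A t *m x) ([set` J] `*` setT)
    (fun p => (dotv (re_cV nu) p.2 ^+ 2 + dotv (im_cV nu) p.2 ^+ 2) *
       expR (- 2 * oriented_int (fun z => complex.Re (lambda z)) t0 p.1)).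
Proof.
set u := re_cV nu; set v := im_cV nu; set l := fun t => complex.Re (lambda t).
move=> lc lnu t0J; set I := oriented_int l t0.
have Ic := oriented_int_within_continuous lc t0J.
have Ec : {within [set` J] `*` setT,
    continuous (fun p : R * 'cV[R]_n => expR (- 2 * I p.1))}.
  apply: within_continuous_comp; first exact: continuous_expR.
  apply: within_continuousM; first exact: within_continuous_cst.
  exact: within_continuous_fst.
have dc w := @within_continuous_dotv_snd R n w ([set` J] `*` setT).
exists (fun p => (dotv u p.2 ^+ 2 + dotv v p.2 ^+ 2) *
  (expR (- 2 * I p.1) * (- 2 * l p.1))).
exists (fun k p => (2 * dotv u p.2 * u k ord0 + 2 * dotv v p.2 * v k ord0) *
  expR (- 2 * I p.1)).
split.
- apply: within_continuousM.
    by apply: within_continuousD; apply: within_continuousM; exact: dc.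
  apply: within_continuousM; first exact: Ec.
  apply: within_continuousM; first exact: within_continuous_cst.
  exact: within_continuous_fst.
- move=> k; apply: within_continuousM; last exact: Ec.
  by apply: within_continuousD; do 2?[apply: within_continuousM;
    last by [exact: dc|exact: within_continuous_cst]];
    exact: within_continuous_cst.
- move=> [t x] [/= tJ _].
  (* The integral is replaced by a local primitive [P], which is differentiable at [t] in the
     ordinary sense even if [t] is an endpoint of [J]. *)
  have [P [dP PE]] := oriented_int_local_primitive lc t0J tJ.
  apply: (derives_within_line (s := t) (g := fun s =>
    (dotv u x ^+ 2 + dotv v x ^+ 2) * expR (- 2 * P s))) => //.
    rewrite /= /I (nbhs_singleton PE tJ).
    exact: is_deriveZ.
  by apply: filterS PE => s PE; rewrite time_line => -[/= /PE <-].
- move=> [t x] k [/= tJ _].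
  (* On a coordinate line both linear forms are affine in [h], and the exponential is a constant
     factor. *)
  apply: (derives_within_line (s := 0) (g := fun h =>
    expR (- 2 * I t) *
    ((h * u k ord0 + dotv u x) ^+ 2 + (h * v k ord0 + dotv v x) ^+ 2))) => //.
    have := is_deriveD (is_derive_affine_sq (u k ord0) (dotv u x) 0)
      (is_derive_affine_sq (v k ord0) (dotv v x) 0).
    rewrite !mul0r !add0r => H.
    by rewrite /= [X in is_derive _ _ _ X]mulrC; exact: is_deriveZ.
  by near=> h => _; rewrite space_line /= !dotv_line [RHS]mulrC.
- move=> [t x] [/= tJ _].
  under eq_bigr do rewrite mulrA mulrDr.
  rewrite -mulr_suml big_split/=.
  rewrite !sum_mul_dotv (dotv_re_eigen x (lnu t tJ)).
  rewrite (dotv_im_eigen x (lnu t tJ)).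
  rewrite -/u -/v /l; ring.
Unshelve. all: by end_near. Qed.

(** The space gradient of [atan (beta / alpha)] is [(alpha v - beta u) / (alpha^2 + beta^2)]. Paired
    with [A x], its terms in Re lambda cancel and Im lambda remains, offset by the time derivative
    of the integral. *)
Lemma first_integral_argument (R : realType) (n : nat) (J : interval R)
    (A : R -> 'M[R]_n) (nu : 'cV[R[i]]_n) (lambda : R -> R[i]) (t0 : R)
    (X : set 'cV[R]_n) :
  {within [set` J], continuous (fun t => complex.Im (lambda t))} ->
  (forall t, t \in J -> complex_mx (A t)^T *m nu = lambda t *: nu) ->
  t0 \in J -> X `<=` [set x | dotv (re_cV nu) x != 0] ->
  first_integral (fun t x => A t *m x) ([set` J] `*` X)
    (fun p => atan (dotv (im_cV nu) p.2 / dotv (re_cV nu) p.2) -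
       oriented_int (fun z => complex.Im (lambda z)) t0 p.1).
Proof.
set u := re_cV nu; set v := im_cV nu; set l := fun t => complex.Im (lambda t).
move=> lc lnu t0J X0; set I := oriented_int l t0.
have dc w := @within_continuous_dotv_snd R n w ([set` J] `*` X).
have sq0 x : X x -> dotv u x ^+ 2 + dotv v x ^+ 2 != 0.
  move=> /X0 /= ux0; rewrite gt_eqF// ltr_pwDl ?sqr_ge0//.
  by rewrite exprn_even_gt0.
exists (fun p => - l p.1).
exists (fun k p => (v k ord0 * dotv u p.2 - dotv v p.2 * u k ord0) /
  (dotv u p.2 ^+ 2 + dotv v p.2 ^+ 2)).
split.
- by apply: within_continuousN; exact: within_continuous_fst.
- move=> k; apply: within_continuousM.
    apply: within_continuousD; last apply: within_continuousN;
      by apply: within_continuousM; try exact: dc; exact: within_continuous_cst.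
  apply: within_continuousV; last by move=> p [_ /sq0].
  by apply: within_continuousD; apply: within_continuousM; exact: dc.
- move=> [t x] [/= tJ Xx].
  have [P [dP PE]] := oriented_int_local_primitive lc t0J tJ.
  apply: (derives_within_line (s := t) (g := fun s =>
    atan (dotv v x / dotv u x) - P s)) => //.
    rewrite -[X in is_derive _ _ _ X]add0r.
    by apply: (@is_deriveB _ _ _ (cst _)).
  by apply: filterS PE => s PE; rewrite time_line => -[/= /PE <-].
- move=> [t x] k [/= tJ Xx].
  have ux0 : dotv u x != 0 := X0 _ Xx.
  apply: (derives_within_line (s := 0) (g := fun h =>
    atan ((h * v k ord0 + dotv v x) / (h * u k ord0 + dotv u x)) - I t)) => //.
    rewrite -[X in is_derive _ _ _ X]subr0.
    apply: (@is_deriveB _ _ _ _ (cst _)).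
    have dq : is_derive (0 : R) 1
        (fun h => (h * v k ord0 + dotv v x) / (h * u k ord0 + dotv u x))
        (v k ord0 / dotv u x - dotv v x * u k ord0 / dotv u x ^+ 2).
      have den0 : (0 : R) * u k ord0 + dotv u x != 0 by rewrite mul0r add0r.
      have := is_deriveM (is_derive_affine (v k ord0) (dotv v x) 0)
        (@is_deriveV _ (fun h => h * u k ord0 + dotv u x) 0 _ 1 den0
          (is_derive_affine (u k ord0) (dotv u x) 0)).
      move/is_derive_eq; apply.
      by rewrite /GRing.scale/= !mul0r !add0r; field.
    have := @is_derive1_comp _ atan _ (0 : R) _ _ (is_derive1_atan _) dq.
    move/is_derive_eq; apply.
    (* With [q = beta / alpha], the factor [1 / (1 + q^2)] turns the denominator [alpha^2] of [q']
       into [alpha^2 + beta^2]. *)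
    rewrite !mul0r !add0r.
    by field; rewrite ux0 ?sq0// addrC sq0.
  (* The two expressions agree for every [h], including where the denominator vanishes and the
     quotient takes its default value 0. *)
  by near=> h => _; rewrite space_line /= !dotv_line.
- move=> [t x] [/= tJ Xx].
  under eq_bigr do rewrite mulrA mulrBr.
  rewrite -mulr_suml sumrB/=.
  under eq_bigr do rewrite [v _ _ * _]mulrC.
  rewrite !sum_mul_dotv.
  rewrite (dotv_re_eigen x (lnu t tJ)) (dotv_im_eigen x (lnu t tJ)).
  rewrite -/u -/v /l; by field; exact: sq0.
Unshelve. all: by end_near. Qed.

Unset Implicit Arguments.
Set Strict Implicit.

Theorem theorem2p3 (R : realType) (n : nat) (J : interval R)
    (A : R -> 'M[R]_n)
    (A_cont : {within [set` J], continuous A})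
    (A_diag : exists S : 'M[R[i]]_n, S \in unitmx /\
       forall t : R, t \in J ->
         is_diag_mx (invmx S *m complex_mx (A t) *m S))
    (nu : 'cV[R[i]]_n) (lambda : R -> R[i])
    (nu_im : im_cV nu != 0)
    (nu_eigen : forall t : R, t \in J ->
       complex_mx (A t)^T *m nu = lambda t *: nu)
    (t0 : R) (t0J : t0 \in J) :
  first_integral (fun t x => A t *m x) ([set` J] `*` setT)
    (fun p => (dotv (re_cV nu) p.2 ^+ 2 + dotv (im_cV nu) p.2 ^+ 2) *
       expR (- 2 * oriented_int (fun z => complex.Re (lambda z)) t0 p.1)) /\
  (forall XX : set 'cV[R]_n,
     is_domain R XX ->
     XX `<=` [set x | dotv (re_cV nu) x != 0] ->
     first_integral (fun t x => A t *m x) ([set` J] `*` XX)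
       (fun p => atan (dotv (im_cV nu) p.2 / dotv (re_cV nu) p.2) -
          oriented_int (fun z => complex.Im (lambda z)) t0 p.1)).

Proof.
(* A nonzero imaginary part makes [nu] nonzero, as the continuity of [lambda] requires. *)
have nu0 : nu != 0.
  by apply: contraNneq nu_im => ->; apply/eqP/matrixP => k j; rewrite !mxE.
have [rec imc] := eigenfunction_continuous A_cont nu0 nu_eigen.
split; first exact: first_integral_modulus.
by move=> XX _ XX0; exact: first_integral_argument.
Qed.
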